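(* Let $\Gamma$ be an amply regular graph with parameters $(v,k,\lambda,\mu)$ having smallest eigenvalue $-m$ such that $\mu > m(m-1)$. Suppose that $\Gamma$ has a maximal clique $C$ of order $c > \frac{\mu^2}{\mu-m(m-1)}-m+1$. Then $$\bigl((c+m-3)(k-c+1)-2(c-1)(\lambda-c+2)\bigr)^2-(k-c+1)^2(c+m-1)\bigl(c-(m-1)(4m-1)\bigr) \geqslant 0.$$
   Context: All graphs are finite, undirected and simple. A regular graph with $v$ vertices and valency $k$ is edge-regular with parameters $(v,k,\lambda)$ if any two adjacent vertices have exactly $\lambda$ common neighbors. An edge-regular graph with parameters $(v,k,\lambda)$ is amply regular with parameters $(v,k,\lambda,\mu)$ if any two vertices at distance $2$ have exactly $\mu$ common neighbors. Eigenvalues of a graph are the eigenvalues of its adjacency matrix. A clique is a set of pairwise adjacent vertices; its order is its number of vertices; it is maximal if it is not properly contained in another clique. *)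

(* Defs.v *)
From mathcomp Require Import all_boot all_order all_algebra.

Set Implicit Arguments.
Unset Strict Implicit.
Unset Printing Implicit Defensive.

Import Order.TTheory GRing.Theory Num.Theory.
Local Open Scope ring_scope.

Definition simple_graph (T : finType) (e : rel T) : Prop :=
  symmetric e /\ irreflexive e.

Definition neighbors (T : finType) (e : rel T) (x : T) : {set T} :=
  [set y | e x y].

Definition at_distance (T : finType) (e : rel T) (n : nat) (x y : T) : Prop :=
  (exists p : seq T, [/\ path e x p, last x p = y & size p = n]) /\
  (forall p : seq T, path e x p -> last x p = y -> (n <= size p)%N).

Definition regular (T : finType) (e : rel T) (v k : nat) : Prop :=
  #|T| = v /\ forall x : T, #|neighbors e x| = k.

Definition edge_regular (T : finType) (e : rel T) (v k lambda : nat) : Prop :=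
  regular e v k /\
  forall x y : T, e x y -> #|neighbors e x :&: neighbors e y| = lambda.

Definition amply_regular (T : finType) (e : rel T)
    (v k lambda mu : nat) : Prop :=
  edge_regular e v k lambda /\
  forall x y : T, at_distance e 2 x y ->
    #|neighbors e x :&: neighbors e y| = mu.

Definition adjacency_mx (R : nzRingType) (T : finType) (e : rel T) :
    'M[R]_#|T| :=
  \matrix_(i, j) (e (enum_val i) (enum_val j))%:R.

(* Over a real closed field the symmetric matrix adjacency_mx R e has all its
   eigenvalues in R, so quantifying over R misses none of them. *)
Definition smallest_eigenvalue (R : rcfType) (T : finType) (e : rel T)
    (a : R) : Prop :=
  eigenvalue (adjacency_mx R e) a /\
  forall b : R, eigenvalue (adjacency_mx R e) b -> a <= b.

Definition clique (T : finType) (e : rel T) (C : {set T}) : bool :=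
  [forall x in C, forall y in C, (x != y) ==> e x y].

Definition maximal_clique (T : finType) (e : rel T) (C : {set T}) : bool :=
  maxset (clique e) C.

(* Main.v *)
(** Let [x] be a vertex outside [C] with [b > 0] neighbours in [C], and put
    [s = c + m - 1]. Positive semidefiniteness of [A + m I] on [C] and [x] gives
    [b ^ 2 - s b + m (m - 1) s >= 0], while by maximality some vertex of [C] is
    at distance 2 from [x], so that [b <= mu]. The bound on [c] says that [mu]
    lies strictly between the roots of this quadratic, so [b] is at most its
    smaller root [beta]. Summing [b (b - 1) <= (beta - 1) b] over all [x] outside
    [C], where [\sum b = c (k - c + 1)] and
    [\sum b (b - 1) = c (c - 1) (lambda - c + 2)], gives
    [(c - 1) (lambda - c + 2) <= (beta - 1) (k - c + 1)]; isolating the square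
    root in [beta] and squaring yields the claim. *)

Require Import Defs.
From mathcomp Require Import all_boot all_order all_algebra.
From mathcomp Require Import complex ring lra.

Set Implicit Arguments.
Unset Strict Implicit.
Unset Printing Implicit Defensive.

Import Order.TTheory GRing.Theory Num.Theory.
Local Open Scope ring_scope.

(** * Rayleigh bound for symmetric matrices over a real closed field *)

(** Over [R[i]] the matrix is Hermitian, hence unitarily diagonalisable; in an eigenbasis the form
    is a sum of squared moduli weighted by eigenvalues, each at least [a]. *)
Lemma symmetric_form_ge (R : rcfType) n (A : 'M[R]_n) (a : R) (u : 'rV_n) :
  A^T = A -> (forall b, eigenvalue A b -> a <= b) ->
  a * (u *m u^T) 0 0 <= (u *m A *m u^T) 0 0.
Proof.
move=> symA minA; pose f := real_complex R.
pose B := map_mx f A; pose P := spectralmx B; pose d := spectral_diag B.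
have conj_real p q (M : 'M[R]_(p, q)) : map_mx Num.conj (map_mx f M) = map_mx f M.
  by apply/matrixP=> i j; rewrite !mxE; apply/CrealP/complex_realP; exists (M i j).
have hermB : B \is hermsymmx.
  apply/is_hermitianmxP; rewrite expr0 scale1r -map_trmx conj_real.
  by rewrite map_trmx symA.
have Punit : P \in unitmx := spectral_unit B.
have PV : invmx P = map_mx Num.conj P^T.
  exact: (invmx_unitary (spectral_unitarymx B)).
have /orthomx_spectralP defB := hermitian_normalmx hermB.
(* Row [i] of [P] is an eigenvector for the real number [d 0 i]; through the characteristic
   polynomial, that number comes from an eigenvalue of [A]. *)
have d_ge i : f a <= d 0 i.
  have /mxOverP/(_ 0 i)/complex_realP[b db] := hermitian_spectral_diag_real hermB.
  rewrite -/d in db; rewrite db lecR; apply: minA.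
  rewrite eigenvalue_root_char -(fmorph_root f) map_char_poly.
  rewrite -eigenvalue_root_char; apply/eigenvalueP; exists (row i P).
    rewrite -/B -row_mul {1}defB -/P -/d mulmxA mulmxA mulmxV // mul1mx.
    by rewrite row_mul row_diag_mx -scalemxAl -rowE db.
  apply/eqP=> /(congr1 (mulmx^~ (invmx P))).
  rewrite -row_mul mulmxV // mul0mx => /rowP/(_ i).
  by rewrite !mxE eqxx => /eqP; rewrite oner_eq0.
pose w := map_mx f u *m invmx P.
have wV : map_mx Num.conj w^T = P *m map_mx f u^T.
  rewrite /w trmx_mul map_mxM PV map_trmx trmxK -map_mx_comp.
  rewrite -[in RHS](conj_real _ _ u^T) map_trmx; congr (_ *m _).
  by apply/matrixP=> p q; rewrite !mxE /= conjCK.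
have normE : f ((u *m u^T) 0 0) = \sum_i `|w 0 i| ^+ 2.
  transitivity ((w *m map_mx Num.conj w^T) 0 0).
    by rewrite wV /w mulmxA mulmxKV // -map_mxM [RHS]mxE.
  by rewrite mxE; apply: eq_bigr => i _; rewrite !mxE normCK.
have formE : f ((u *m A *m u^T) 0 0) = \sum_i d 0 i * `|w 0 i| ^+ 2.
  transitivity ((w *m diag_mx d *m map_mx Num.conj w^T) 0 0).
    have -> : w *m diag_mx d *m map_mx Num.conj w^T
      = map_mx f u *m B *m map_mx f u^T by rewrite wV {1}defB -/P -/d /w !mulmxA.
    by rewrite -!map_mxM [RHS]mxE.
  rewrite mxE; apply: eq_bigr => i _.
  by rewrite mul_mx_diag !mxE normCK mulrAC mulrC.
have fM x y : f (x * y) = f x * f y by exact: rmorphM.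
suff: f (a * (u *m u^T) 0 0) <= f ((u *m A *m u^T) 0 0) by rewrite lecR.
rewrite fM normE formE mulr_sumr ler_sum // => i _.
by rewrite ler_wpM2r // exprn_ge0.
Qed.

Lemma adjacency_form_ge (R : rcfType) (T : finType) (e : rel T) (a : R)
    (f : T -> R) :
  symmetric e -> smallest_eigenvalue e a ->
  a * \sum_x f x ^+ 2 <= \sum_x \sum_y f x * f y * (e x y)%:R.
Proof.
move=> symE [_ minA]; pose u := \row_i f (enum_val i) : 'rV_#|T|.
have symA : (adjacency_mx R e)^T = adjacency_mx R e.
  by apply/matrixP=> i j; rewrite !mxE symE.
have sumT (F : T -> R) : \sum_x F x = \sum_(i < #|T|) F (enum_val i).
  exact/reindex/onW_bij/enum_val_bij.
have := symmetric_form_ge u symA minA; congr (a * _ <= _).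
  rewrite mxE sumT; apply: eq_bigr => i _.
  by rewrite !mxE expr2.
rewrite -mulmxA mxE sumT; apply: eq_bigr => i _.
rewrite !mxE sumT mulr_sumr; apply: eq_bigr => j _.
by rewrite !mxE; ring.
Qed.

(** * Cliques and the form of [A + m I] *)

Lemma clique_adj (T : finType) (e : rel T) (C : {set T}) y z :
  irreflexive e -> clique e C -> y \in C -> z \in C -> e y z = (y != z).
Proof.
move=> irrE /forall_inP clC yC zC; have [<-|neq_yz] := eqVneq y z.
  exact: irrE.
by have /forall_inP/(_ z zC)/implyP/(_ neq_yz) := clC y yC.
Qed.

Lemma clique_sub (T : finType) (e : rel T) (B C : {set T}) :
  B \subset C -> clique e C -> clique e B.
Proof.
move=> /subsetP sBC /forall_inP clC; apply/forall_inP=> y /sBC yC.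
by apply/forall_inP=> z /sBC; move: z; apply/forall_inP/clC.
Qed.

Lemma card_neighborsE (R : pzSemiRingType) (T : finType) (e : rel T)
    (C : {set T}) (x : T) :
  #|neighbors e x :&: C|%:R = \sum_(y in C) (e x y)%:R :> R.
Proof.
rewrite -natr_sum -sum1_card big_mkcond [in RHS]big_mkcond /=.
by congr _%:R; apply: eq_bigr => y _; rewrite !inE; case: (e x y); case: (y \in C).
Qed.

(** This is the form of [A + m I] at the vector equal to [a] at [x], to [g] on [C] and to 0
    elsewhere: on a clique [A] restricts to [J - I], with [J] the all-ones matrix. *)
Lemma clique_form_ge0 (R : rcfType) (T : finType) (e : rel T) (m a : R)
    (C : {set T}) (x : T) (g : T -> R) :
  simple_graph e -> smallest_eigenvalue e (- m) -> clique e C -> x \notin C ->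
  0 <= (\sum_(y in C) g y) ^+ 2 + (m - 1) * \sum_(y in C) g y ^+ 2
       + 2 * a * \sum_(y in C) g y * (e x y)%:R + m * a ^+ 2.
Proof.
move=> [symE irrE] minE clC xC.
pose h y := if y == x then a else if y \in C then g y else 0.
have sum_h F : (forall y, F y 0 = 0) ->
    \sum_y F y (h y) = F x a + \sum_(y in C) F y (g y) :> R.
  move=> F0; rewrite (bigD1 x) //= {1}/h eqxx; congr (_ + _).
  rewrite big_mkcond [RHS]big_mkcond /=; apply: eq_bigr => y _; rewrite /h.
  by have [->|_] := eqVneq y x; rewrite ?(negPf xC) //=; case: ifP.
have := adjacency_form_ge h symE minE.
rewrite (sum_h (fun _ r => r ^+ 2)) => [|y]; last by rewrite expr0n.
have inner y : \sum_z h y * h z * (e y z)%:R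
    = h y * (a * (e y x)%:R + \sum_(z in C) g z * (e y z)%:R).
  rewrite (sum_h (fun z r => h y * r * (e y z)%:R)) => [|z].
    by rewrite mulrDr mulr_sumr mulrA; congr (_ + _); apply: eq_bigr => z _;
       rewrite mulrA.
  by rewrite mulr0 mul0r.
rewrite (eq_bigr _ (fun y _ => inner y)).
rewrite (sum_h (fun y r => r * (a * (e y x)%:R + \sum_(z in C) g z * (e y z)%:R)))
  => [|y]; last by rewrite mul0r.
have -> : \sum_(y in C) g y * (a * (e y x)%:R + \sum_(z in C) g z * (e y z)%:R)
    = a * (\sum_(y in C) g y * (e x y)%:R)
      + ((\sum_(y in C) g y) ^+ 2 - \sum_(y in C) g y ^+ 2).
  rewrite expr2 mulr_suml mulr_sumr -sumrB -big_split /=.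
  apply: eq_bigr => y yC.
  have -> : \sum_(z in C) g z * (e y z)%:R = \sum_(z in C) g z - g y.
    rewrite (bigD1 y) //= irrE mulr0 add0r [in RHS](bigD1 y) //= [RHS]addrC addKr.
    apply: eq_bigr => z /andP[zC neq_zy].
    by rewrite (clique_adj irrE clC) // eq_sym neq_zy mulr1.
  by rewrite (symE y x); ring.
by rewrite irrE mulr0 add0r; lra.
Qed.

Section CliqueNeighbors.
Variables (R : rcfType) (T : finType) (e : rel T) (m : R) (C : {set T}) (x : T).
Hypotheses (He : simple_graph e) (Hm : smallest_eigenvalue e (- m)).
Hypotheses (HC : maximal_clique e C) (xC : x \notin C).

Let symE : symmetric e := proj1 He.
Let irrE : irreflexive e := proj2 He.
Let clC : clique e C.
Proof. by have /maxsetP[] := HC. Qed.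

Lemma maximal_clique_nonadj : exists2 y, y \in C & ~~ e x y.
Proof.
apply/exists_inP; apply: contraNT xC => /exists_inPn adjC.
have /maxsetP[_ maxC] := HC.
rewrite -(maxC (x |: C) _ (subsetUr _ _)) ?setU11 //.
apply/forall_inP=> y /setU1P[->|yC]; apply/forall_inP=> z /setU1P[->|zC].
- by rewrite eqxx.
- by rewrite (negPn (adjC z zC)) implybT.
- by rewrite symE (negPn (adjC y yC)) implybT.
by rewrite (clique_adj irrE clC) // implybb.
Qed.

(* The induced path P_3 has smallest eigenvalue [- sqrt 2], so in particular
   [m > 1]. *)
Lemma smallest_eigenvalue_adj_clique z : z \in C -> e x z -> 4 <= 3 * m.
Proof.
move=> zC exz; have [y yC nexy] := maximal_clique_nonadj.
have neq_yz : y != z by apply: contraNneq nexy => ->.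
pose B := [set y; z].
have sBC : B \subset C by apply/subsetP=> w /set2P[] ->.
have xB : x \notin B by apply: contraNN xC; apply/subsetP.
have sumB (F : T -> R) : \sum_(w in B) F w = F y + F z.
  by rewrite big_setU1 ?in_set1 // big_set1.
(* The test vector is 1, -1, 1 along the induced path [x], [z], [y], where the form equals
   [3 * m - 4]. *)
have := clique_form_ge0 1 (fun w => (w == y)%:R - (w == z)%:R) He Hm
          (clique_sub sBC clC) xB.
rewrite !sumB !eqxx (negPf neq_yz) eq_sym (negPf neq_yz) exz (negPf nexy) /=.
lra.
Qed.

(* The inequality says that the determinant of the quotient of [A + m I] for the
   partition of [x |: C] into [x], its neighbours in [C], and the rest of [C] is
   nonnegative; the test vector is, up to scaling, the minimiser of the form
   with given value at [x]. *)
Lemma clique_neighbors_quadratic (b := #|neighbors e x :&: C|%:R)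
    (s := #|C|%:R + m - 1) :
  (0 < #|neighbors e x :&: C|)%N -> b * (s - b) <= m * (m - 1) * s.
Proof.
case/card_gt0P=> z; rewrite !inE => /andP[exz zC].
have m_ge := smallest_eigenvalue_adj_clique zC exz.
have s_gt0 : 0 < s by have := ler0n R #|C|; rewrite /s; lra.
have sumb : \sum_(y in C) (e x y)%:R = b by rewrite /b card_neighborsE.
(* With value [a = - ((m - 1) * s)] at [x], stationarity reads
   [\sum g + (m - 1) * g y + a * e x y = 0]; this [g] solves it because [\sum g = (m - 1) * b]. *)
pose g y := s * (e x y)%:R - b.
have := clique_form_ge0 (- ((m - 1) * s)) g He Hm clC xC.
have lin p q F : (forall y, F y = p * (e x y)%:R + q) ->
    \sum_(y in C) F y = p * b + q * #|C|%:R.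
  move=> FE; rewrite (eq_bigr _ (fun y _ => FE y)) big_split /= -mulr_sumr sumb.
  by rewrite sumr_const mulr_natr.
rewrite (lin s (- b) g) // (lin (s ^+ 2 - 2 * s * b) (b ^+ 2)); last first.
  by move=> y; rewrite /g; case: (e x y) => /=; ring.
rewrite (lin (s - b) 0); last by move=> y; rewrite /g; case: (e x y) => /=; ring.
have -> : #|C|%:R = s - m + 1 by rewrite /s; ring.
move=> form_ge0; have : 0 <= (m - 1) * s * (m * (m - 1) * s - b * (s - b)).
  by apply: le_trans form_ge0 _; rewrite le_eqVlt; apply/orP; left; apply/eqP; ring.
by rewrite pmulr_rge0 ?subr_ge0 // mulr_gt0 //; lra.
Qed.

(** All neighbours of [x] in [C] are also neighbours of a vertex [y] of [C] not adjacent to [x], and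
    any one of them puts [y] at distance 2. *)
Lemma clique_neighbors_le_mu v k lambda mu :
  amply_regular e v k lambda mu -> (0 < #|neighbors e x :&: C|)%N ->
  (#|neighbors e x :&: C| <= mu)%N.
Proof.
move=> [_ muE] /card_gt0P[z]; rewrite !inE => /andP[exz zC].
have [y yC nexy] := maximal_clique_nonadj.
have adjy w : w \in C -> e x w -> e y w.
  move=> wC exw; rewrite (clique_adj irrE clC) //.
  by apply: contraNneq nexy => ->.
rewrite -(muE x y).
  by apply/subset_leq_card/subsetP=> w; rewrite !inE => /andP[exw wC];
     rewrite exw adjy.
split=> [|[|w [|w' p]] //=].
- by exists [:: z; y]; split=> //=; rewrite exz symE adjy.
- by move=> _ xy; have := xC; rewrite xy yC.
by move=> /andP[exw _] wy; rewrite -wy exw in nexy.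
Qed.

End CliqueNeighbors.

(* [q] stands for [m (m - 1)]; the hypotheses on [mu] place it strictly between
   the roots of [X^2 - s X + q s], hence [b] below the smaller one. *)
Lemma quadratic_root_gap (R : rcfType) (b mu s q : R) :
  b <= mu -> mu ^+ 2 < s * (mu - q) -> b * (s - b) <= q * s ->
  2 * b <= s - Num.sqrt (s * (s - 4 * q)).
Proof.
move=> b_mu mu_lt b_ge; set D := s * _.
(* The hypotheses amount to [(2 * mu - s) ^+ 2 < D <= (2 * b - s) ^+ 2]. *)
have D_ge0 : 0 <= D by rewrite /D; have := sqr_ge0 (2 * mu - s); nra.
have r_ge0 := sqrtr_ge0 D; have := sqr_sqrtr D_ge0; set r := Num.sqrt D in r_ge0 *.
move=> rD; rewrite leNgt; apply/negP=> b_gt.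
have : 2 * mu - s < r by rewrite /D in rD; nra.
rewrite /D in rD; nra.
Qed.

(** * Double counting of edges and paths leaving the clique *)

(** Of the [k] or [lambda] common neighbours of [y] and [z], those inside [C] number [#|C| - 1] if
    [y = z] and [#|C| - 2] otherwise. *)
Lemma sum_common_outside (R : rcfType) (T : finType) (e : rel T)
    (v k lambda : nat) (C : {set T}) (y z : T) :
  simple_graph e -> edge_regular e v k lambda -> clique e C ->
  y \in C -> z \in C ->
  \sum_(x | x \notin C) (e x y)%:R * (e x z)%:R
    = (if y == z then k%:R - #|C|%:R + 1 else lambda%:R - #|C|%:R + 2) :> R.
Proof.
move=> [symE irrE] [[_ regE] lamE] clC yC zC.
have in_out : \sum_x (e x y)%:R * (e x z)%:R
    = \sum_(x in C) (e x y)%:R * (e x z)%:R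
      + \sum_(x | x \notin C) (e x y)%:R * (e x z)%:R :> R.
  exact: bigID.
have all_ : \sum_x (e x y)%:R * (e x z)%:R
    = (#|neighbors e y :&: neighbors e z|)%:R :> R.
  rewrite -sum1_card [in RHS]big_mkcond natr_sum; apply: eq_bigr => x _.
  by rewrite !inE !(symE x); case: (e y x); case: (e z x); rewrite ?mulr1 ?mulr0.
have delta w : w \in C -> \sum_(x in C) ((x == w)%:R : R) = 1.
  move=> wC; rewrite (bigD1 w) //= eqxx big1 ?addr0 // => x /andP[_ neq_xw].
  by rewrite (negPf neq_xw).
have sum1 : \sum_(x in C) (1 : R) = #|C|%:R by rewrite sumr_const.
have in_ : \sum_(x in C) (e x y)%:R * (e x z)%:R
    = #|C|%:R - 2 + (y == z)%:R :> R.
  (* The summand is the indicator of [x] differing from both [y] and [z], by inclusion-exclusion. *)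
  have -> : #|C|%:R - 2 + (y == z)%:R = \sum_(x in C)
      (1 - (x == y)%:R - (x == z)%:R + (y == z)%:R * (x == z)%:R) :> R.
    by rewrite big_split /= -mulr_sumr !sumrB !delta // sum1; ring.
  apply: eq_bigr => x xC; rewrite !(clique_adj irrE clC) //.
  case: (eqVneq x y) => [<-|nxy]; case: (eqVneq x z) => [xz|_] /=.
  - by ring.
  - by ring.
  - by rewrite -xz eq_sym (negPf nxy) /=; ring.
  - by ring.
move: in_out; rewrite all_ in_; have [<-|neq_yz] := eqVneq y z.
  by rewrite setIid regE => -> /=; ring.
by rewrite lamE ?(clique_adj irrE clC) // => -> /=; ring.
Qed.

(** The square of [b x] counts ordered pairs of neighbours of [x] in [C]; the two terms of the
    second sum come from equal and from distinct pairs. *)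
Lemma clique_double_count (R : rcfType) (T : finType) (e : rel T)
    (v k lambda : nat) (C : {set T}) (b := fun x => #|neighbors e x :&: C|)
    (c := #|C|%:R : R) :
  simple_graph e -> edge_regular e v k lambda -> clique e C ->
  \sum_(x | x \notin C) (b x)%:R = c * (k%:R - c + 1) /\
  \sum_(x | x \notin C) (b x)%:R ^+ 2
    = c * (k%:R - c + 1) + c * (c - 1) * (lambda%:R - c + 2).
Proof.
move=> He Hreg clC.
have bE x := card_neighborsE R e C x.
split.
  rewrite (eq_bigr _ (fun x _ => bE x)) exchange_big /=.
  rewrite mulr_natl -sumr_const; apply: eq_bigr => y yC.
  have := sum_common_outside R He Hreg clC yC yC; rewrite eqxx => <-.
  by apply: eq_bigr => x _; case: (e x y); rewrite ?mulr1 ?mulr0.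
transitivity (\sum_(y in C) \sum_(z in C)
    \sum_(x | x \notin C) ((e x y)%:R * (e x z)%:R : R)).
  rewrite (eq_bigr (fun x => \sum_(y in C) \sum_(z in C) (e x y)%:R * (e x z)%:R)).
    by rewrite exchange_big; apply: eq_bigr => y _; rewrite exchange_big.
  by move=> x _; rewrite bE expr2 mulr_suml; apply: eq_bigr => y _; rewrite mulr_sumr.
have -> : c * (k%:R - c + 1) + c * (c - 1) * (lambda%:R - c + 2)
    = c * ((k%:R - c + 1) + (c - 1) * (lambda%:R - c + 2)) by ring.
rewrite mulr_natl -sumr_const; apply: eq_bigr => y yC.
rewrite (bigD1 y) //= (sum_common_outside R He Hreg clC yC yC) eqxx; congr (_ + _).
have -> : c - 1 = #|C :\ y|%:R by rewrite /c (cardsD1 y) yC natrD addrC addKr.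
rewrite mulr_natl -sumr_const; apply: eq_big => [z|z /andP[zC neq_zy]].
  by rewrite !inE andbC.
by rewrite (sum_common_outside R He Hreg clC yC zC) eq_sym (negPf neq_zy).
Qed.

(** An eigenvector has a nonzero entry, so there is a vertex, and its singleton is a clique.
    Positivity of [c] later allows cancelling it. *)
Lemma maximal_clique_gt0 (R : rcfType) (T : finType) (e : rel T) (a : R)
    (C : {set T}) :
  smallest_eigenvalue e a -> maximal_clique e C -> (0 < #|C|)%N.
Proof.
move=> [/eigenvalueP[u _ /rV0Pn[i _]] _] /maxsetP[_ maxC].
rewrite lt0n cards_eq0; apply/eqP=> C0.
suff: enum_val i \in C by rewrite C0 inE.
rewrite -(maxC [set enum_val i]) ?set11 ?C0 ?sub0set //.
by apply/forall_inP=> y /set1P->; apply/forall_inP=> z /set1P->; rewrite eqxx.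
Qed.

Theorem lemma3p7 (R : rcfType) (T : finType) (e : rel T)
    (v k lambda mu : nat) (m : R) (C : {set T}) (c : nat)
    (He : simple_graph e)
    (Hreg : amply_regular e v k lambda mu)
    (Hm : smallest_eigenvalue e (- m))
    (Hmu : mu%:R > m * (m - 1))
    (HC : maximal_clique e C)
    (Hc : #|C| = c)
    (Hcbound : c%:R > mu%:R ^+ 2 / (mu%:R - m * (m - 1)) - m + 1) :
  ((c%:R + m - 3) * (k%:R - c%:R + 1)
     - 2 * (c%:R - 1) * (lambda%:R - c%:R + 2)) ^+ 2
  - (k%:R - c%:R + 1) ^+ 2 * (c%:R + m - 1)
     * (c%:R - (m - 1) * (4 * m - 1)) >= 0.
Proof.
have clC : clique e C by have /maxsetP[] := HC.
have c_gt0 : 0 < c%:R :> R by rewrite -Hc ltr0n (maximal_clique_gt0 Hm HC).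
pose s : R := c%:R + m - 1; pose q := m * (m - 1).
pose D := s * (s - 4 * q); pose r := Num.sqrt D.
have mu_lt : mu%:R ^+ 2 < s * (mu%:R - q).
  by rewrite -ltr_pdivrMr ?subr_gt0 // /s /q; lra.
pose b x : R := #|neighbors e x :&: C|%:R.
(* Here [(s - r) / 2] is the smaller root [beta]; the factor [b x] on both sides covers vertices
   without neighbours in [C]. *)
have b_le x : x \notin C -> 2 * b x ^+ 2 <= (s - r) * b x.
  move=> xC; have [b0|b_gt0] := posnP #|neighbors e x :&: C|.
    by rewrite /b b0 expr0n !mulr0.
  have b_mu : b x <= mu%:R.
    by rewrite ler_nat (clique_neighbors_le_mu He HC xC Hreg b_gt0).
  rewrite expr2 mulrA ler_wpM2r ?ler0n //.
  apply: quadratic_root_gap b_mu mu_lt _.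
  by have := clique_neighbors_quadratic He Hm HC xC b_gt0; rewrite Hc.
have [sum_b sum_b2] := clique_double_count R He (proj1 Hreg) clC.
rewrite -/b Hc in sum_b sum_b2.
set S := k%:R - c%:R + 1 in sum_b sum_b2 *.
set L := lambda%:R - c%:R + 2 in sum_b2 *.
have S_ge0 : 0 <= S.
  by rewrite -(pmulr_rge0 _ c_gt0) -sum_b sumr_ge0 // => x _; apply: ler0n.
have : 2 * (c%:R * S + c%:R * (c%:R - 1) * L) <= (s - r) * (c%:R * S).
  by rewrite -sum_b2 -sum_b !mulr_sumr ler_sum.
have -> : 2 * (c%:R * S + c%:R * (c%:R - 1) * L)
    = c%:R * (2 * S + 2 * (c%:R - 1) * L) by ring.
rewrite mulrCA ler_pM2l // => rS_le.
set X := (c%:R + m - 3) * S - _.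
have {}rS_le : r * S <= X by rewrite /X; move: rS_le; rewrite /s; lra.
(* [Num.sqrt] is 0 on negative arguments, so this holds for either sign of [D]. *)
have D_le : D <= r ^+ 2.
  have [D_ge0|D_lt0] := leP 0 D; first by rewrite sqr_sqrtr.
  exact: le_trans (ltW D_lt0) (sqr_ge0 r).
have -> : S ^+ 2 * (c%:R + m - 1) * (c%:R - (m - 1) * (4 * m - 1)) = D * S ^+ 2.
  by rewrite /D /s /q; ring.
rewrite subr_ge0; apply: le_trans (_ : (r * S) ^+ 2 <= _).
  by rewrite exprMn ler_wpM2r ?sqr_ge0.
by rewrite lerXn2r ?nnegrE ?mulr_ge0 ?sqrtr_ge0 //; apply: le_trans rS_le;
   rewrite mulr_ge0 ?sqrtr_ge0.
Qed.
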